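(* Let $n\ge2$ and let $\omega\in\mathbb{R}^n$ be non-resonant. Then $\omega\in\mathcal{B}$ if and only if there exists a non quasi-analytic weight $\varphi\in NQ$ such that the equation $X_\omega g=f-c$ can be solved in $\mathcal{F}^\varphi_\infty$, i.e. such that for every $f\in\mathcal{F}^\varphi_\infty$ the solution $g$ of $X_\omega g=f-c$ belongs to $\mathcal{F}^\varphi_\infty$.
   Context: $|x|=\max_{1\le i\le n}|x_i|$ on $\mathbb{R}^n$; $\omega$ is non-resonant if $k\cdot\omega\neq0$ for all nonzero $k\in\mathbb{Z}^n$. A weight is a continuous non-decreasing function $\varphi:[0,+\infty)\to[0,+\infty)$ with $\varphi(0)=0$ and $\ln(1+t)=O(\varphi(t))$ as $t\to+\infty$. A weight is non quasi-analytic if $\int_1^{+\infty}\varphi(t)t^{-2}\,dt<\infty$; $NQ$ is the set of all non quasi-analytic weights. $\mathcal{F}$ is the space of real formal Fourier series $f=\sum_{k\in\mathbb{Z}^n}f_ke_k$, $e_k(x)=e^{2\pi ik\cdot x}$, $f_k\in\mathbb{C}$, $\overline{f_k}=f_{-k}$. For $r\in\mathbb{R}$, $\mathcal{F}^\varphi_r:=\{f\in\mathcal{F}:\sup_{k}|f_k|e^{r\varphi(|k|)}<+\infty\}$, and $\mathcal{F}^\varphi_\infty:=\bigcap_{r>0}\mathcal{F}^\varphi_r$. For $\tau>0$, $\mathcal{A}^\varphi_\tau:=\{\omega\in\mathbb{R}^n:\sup_{k\in\mathbb{Z}^n\setminus\{0\}}|2\pi k\cdot\omega|^{-1}e^{-\tau\varphi(|k|)}<+\infty\}$.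 The set of Bruno vectors is $\mathcal{B}:=\bigcup_{\varphi\in NQ}\mathcal{A}^\varphi_1$. Cohomological equation: given $f\in\mathcal{F}$, find $g\in\mathcal{F}$ and $c\in\mathbb{R}$ with $X_\omega g=f-c$, where $X_\omega$ acts formally as the derivative in the direction $\omega$ (so $(X_\omega g)_k=2\pi i(k\cdot\omega)g_k$). Necessarily $c=f_0$, and ''the solution'' is the unique one normalized by $g_0=0$: $g_k=(2\pi i\,k\cdot\omega)^{-1}f_k$ for $k\ne0$. *)

(* Defs.v *)
From HB Require Import structures.
From mathcomp Require Import all_boot all_order all_algebra.
From mathcomp Require Import all_classical all_reals all_analysis.
From mathcomp Require Import complex.
Set Implicit Arguments.
Unset Strict Implicit.
Unset Printing Implicit Defensive.
Import Order.TTheory GRing.Theory Num.Theory.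
Import numFieldNormedType.Exports.

Local Open Scope classical_set_scope.
Local Open Scope ring_scope.
Local Open Scope complex_scope.

Definition dotz (R : realType) (n : nat) (k : 'rV[int]_n) (omega : 'rV[R]_n) : R :=
  \sum_(i < n) (k ord0 i)%:~R * omega ord0 i.

Definition nonresonant (R : realType) (n : nat) (omega : 'rV[R]_n) : Prop :=
  forall k : 'rV[int]_n, k != 0 -> dotz k omega != 0.

(* The norm of 'rV[R]_n is the maximum norm [mx_norm]. *)
Definition normz (R : realType) (n : nat) (k : 'rV[int]_n) : R :=
  `|map_mx (intmul (1 : R)) k|.

(* The Landau notation [=O_] needs a [filter_on] structure on its filter. *)
Canonical pinfty_filter_on (R : realType) :=
  FilterType (pinfty_nbhs R) _.

(* A function on [0, +oo[ is represented by a function on R whose values at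
   negative arguments are irrelevant. *)
Definition weight (R : realType) (phi : R -> R) : Prop :=
  [/\ {within `[0, +oo[, continuous phi},
      {in `[0, +oo[ &, {homo phi : s t / s <= t}},
      {in `[0, +oo[, forall t, 0 <= phi t},
      phi 0 = 0 &
      (fun t : R => ln (1 + t)) =O_ (pinfty_nbhs R) phi].

Definition NQ {R : realType} : set (R -> R) :=
  [set phi : R -> R | weight phi /\
    (\int[@lebesgue_measure R]_(t in `[1%R, +oo[) (phi t / t ^+ 2)%R%:E < +oo)%E].

(* The inverse is taken in \bar R, where 0^-1 = +oo: resonant vectors are
   excluded. *)
Definition diophantine (R : realType) (n : nat) (phi : R -> R) (tau : R) :
    set 'rV[R]_n :=
  [set omega | (ereal_sup [set (`|2 * pi * dotz k omega|%R%:E)^-1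
                    * (expR (- (tau * phi (normz R k))))%R%:E
                  | k in [set k : 'rV[int]_n | (k != 0)%R]] < +oo)%E].
Arguments diophantine {R} n phi tau.

Definition Bruno {R : realType} {n : nat} : set 'rV[R]_n :=
  \bigcup_(phi in NQ) diophantine n phi 1.

(* A formal Fourier series is identified with the family of its
   coefficients. *)
Definition real_fourier (R : realType) (n : nat) : set ('rV[int]_n -> R[i]) :=
  [set f | forall k, (f k)^*%C = f (- k)].

Definition fourier_r (R : realType) (n : nat) (phi : R -> R) (r : R) :
    set ('rV[int]_n -> R[i]) :=
  [set f | real_fourier f /\
    (ereal_sup [set (Normc.normc (f k) * expR (r * phi (normz R k)))%R%:E
                  | k in [set: 'rV[int]_n]] < +oo)%E].
Arguments fourier_r {R} n phi r.

Definition fourier_oo (R : realType) (n : nat) (phi : R -> R) :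
    set ('rV[int]_n -> R[i]) :=
  \bigcap_(r in [set r : R | 0 < r]) fourier_r n phi r.
Arguments fourier_oo {R} n phi.

Definition fourier_cst (R : realType) (n : nat) (c : R) :
    'rV[int]_n -> R[i] :=
  fun k => if k == 0 then c%:C else 0.
Arguments fourier_cst {R} n c.

Definition Xomega (R : realType) (n : nat) (omega : 'rV[R]_n)
    (g : 'rV[int]_n -> R[i]) : 'rV[int]_n -> R[i] :=
  fun k => 2 * (pi : R)%:C * 'i%C * (dotz k omega)%:C * g k.

Definition cohom_solution (R : realType) (n : nat) (omega : 'rV[R]_n)
    (f g : 'rV[int]_n -> R[i]) (c : R) : Prop :=
  [/\ real_fourier g,
      forall k, Xomega omega g k = f k - fourier_cst n c k &
      g 0 = 0].

Definition cohom_solvable (R : realType) (n : nat) (omega : 'rV[R]_n)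
    (phi : R -> R) : Prop :=
  forall f, fourier_oo n phi f ->
    exists g c, cohom_solution omega f g c /\ fourier_oo n phi g.

(* "The" solution: it exists and is unique, so that the existential in
   [cohom_solvable] is a statement about this [g]. *)
Lemma cohom_solutionP (R : realType) (n : nat) (omega : 'rV[R]_n)
    (f g : 'rV[int]_n -> R[i]) (c : R) :
  nonresonant omega -> real_fourier f ->
  cohom_solution omega f g c <->
  c%:C = f 0 /\
  g = fun k => if k == 0 then 0
               else (2 * (pi : R)%:C * 'i%C * (dotz k omega)%:C)^-1 * f k.
Proof.
move=> nr fr.
have dot0 : dotz 0 omega = 0.
  by rewrite /dotz big1// => i _; rewrite mxE mul0r.
have dotN k : dotz (- k) omega = - dotz k omega.
  by rewrite /dotz -sumrN; apply: eq_bigr => i _; rewrite mxE rmorphN/= mulNr.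
have nz k : k != 0 -> 2 * (pi : R)%:C * 'i%C * (dotz k omega)%:C != 0 :> R[i].
  move=> k0; rewrite !mulf_neq0//.
  - by rewrite (fmorph_eq0 (real_complex R)) gt_eqF// pi_gt0.
  - by rewrite eq_complex/= oner_eq0 andbF.
  - by rewrite (fmorph_eq0 (real_complex R)); exact: nr.
split=> [[gr eqg g0]|[cf ->]].
  split.
    have := eqg 0; rewrite /Xomega g0 mulr0 /fourier_cst eqxx => /esym/eqP.
    by rewrite subr_eq0 => /eqP.
  apply/funext => k; case: eqVneq => [->//|k0].
  have := eqg k; rewrite /Xomega /fourier_cst (negbTE k0) subr0 => <-.
  by rewrite mulKf// nz.
split; last by rewrite eqxx.
- move=> k; rewrite oppr_eq0; case: eqVneq => [_|k0]; first by rewrite conjc0.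
  have cM (x y : R[i]) : (x * y)^*%C = x^*%C * y^*%C by exact: rmorphM.
  rewrite cM; congr (_ * _); last exact: fr.
  apply: etrans (conjc_inv _) _; congr (_^-1).
  have ci : ('i%C : R[i])^*%C = - 'i%C.
    by apply/eqP; rewrite eq_complex/= oppr0 !eqxx.
  have cN (x : R) : (- x)%:C = - x%:C :> R[i] by rewrite rmorphN.
  rewrite 3!cM dotN cN ci (conjc_nat R 2) conjc_real conjc_real.
  by rewrite !(mulrN, mulNr).
- move=> k; rewrite /Xomega /fourier_cst; case: eqVneq => [->|k0].
    by rewrite mulr0 cf subrr.
  by rewrite mulVKf ?nz// subr0.
Qed.

(* Main.v *)
Require Import Defs.
From mathcomp Require Import all_boot all_order all_algebra.
From mathcomp Require Import all_classical all_reals all_analysis.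
From mathcomp Require Import complex measurable_realfun ring.
Import Order.TTheory GRing.Theory Num.Theory.
Import numFieldNormedType.Exports.

Local Open Scope classical_set_scope.
Local Open Scope ring_scope.

(** If [omega] is Diophantine for [phi], dividing [f] by the small divisors costs
    one exponential [expR (tau * phi)], which [fourier_oo] absorbs: the same
    [phi] works.

    Conversely, if the equation is solvable for [phi], then [omega] is
    Diophantine for [phi] with some exponent [tau], hence for the weight
    [tau * phi] with exponent 1. Otherwise there are [u j != 0] with
    [(divisor (u j))^-1 > (j + 1) * expR ((j + 1) * phi |u j|)]. Let [f] be
    the square root of the divisor on the frequencies [u j], [- u j], and 0
    elsewhere. Then [f] is in [fourier_oo], but the coefficient of the
    solution at [u j] has modulus [(divisor (u j))^(-1/2)], which is
    unbounded. *)

Lemma ereal_sup_image_ltyP (R : realType) (T : Type) (A : set T) (F : T -> R) :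
  (ereal_sup [set (F x)%:E | x in A] < +oo)%E <->
  exists M, forall x, A x -> F x <= M.
Proof.
split=> [supF|[M FM]].
  (* The supremum is [-oo] when [A] is empty; the maximum with 0 keeps the bound a real number. *)
  exists (fine (maxe (ereal_sup [set (F x)%:E | x in A]) 0)) => x Ax.
  rewrite -lee_fin fineK; last first.
    by rewrite ge0_fin_numE ?gt_max ?supF ?ltry// le_max lexx orbT.
  by rewrite le_max ereal_sup_ubound//; exists x.
apply: le_lt_trans (ltry M).
by apply: ge_ereal_sup => _ [x Ax <-]; rewrite lee_fin FM.
Qed.

Lemma fourier_rP (R : realType) (n : nat) (phi : R -> R) (r : R)
    (f : 'rV[int]_n -> R[i]) :
  fourier_r n phi r f <-> real_fourier f /\
    exists M, forall k, Normc.normc (f k) * expR (r * phi (normz R k)) <= M.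
Proof.
rewrite /fourier_r /= ereal_sup_image_ltyP.
by split=> -[fr [M fM]]; split=> //; exists M => k *; exact: fM.
Qed.

Definition divisor {R : realType} {n : nat} (omega : 'rV[R]_n) (k : 'rV[int]_n)
  : R := `|2 * pi * dotz k omega|.

Lemma divisor_gt0 {R : realType} {n : nat} (omega : 'rV[R]_n) k :
  nonresonant omega -> k != 0 -> 0 < divisor omega k.
Proof.
by move=> nr k0; rewrite normr_gt0 !mulf_neq0 ?nr// ?pnatr_eq0// gt_eqF ?pi_gt0.
Qed.

(** Non-resonance keeps the divisors away from 0, so the inverse in [\bar R] is the real one. *)
Lemma diophantineP (R : realType) (n : nat) (phi : R -> R) (tau : R)
    (omega : 'rV[R]_n) : nonresonant omega ->
  diophantine n phi tau omega <->
  exists M, forall k, k != 0 ->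
    (divisor omega k)^-1 <= M * expR (tau * phi (normz R k)).
Proof.
move=> nr; rewrite /diophantine /=.
rewrite (_ : [set _ | k in _] = [set ((divisor omega k)^-1 *
    expR (- (tau * phi (normz R k))))%:E | k in [set k : 'rV[int]_n | k != 0]]).
  rewrite ereal_sup_image_ltyP; split=> -[M H]; exists M => k /H;
    by rewrite expRN -ler_pdivrMr ?expR_gt0// ler_pdivrMr ?expR_gt0.
by apply: eq_imagel => k /= k0; rewrite inver gt_eqF ?divisor_gt0.
Qed.

Lemma divisorN {R : realType} {n : nat} (omega : 'rV[R]_n) k :
  divisor omega (- k) = divisor omega k.
Proof.
rewrite /divisor -[RHS]normrN -mulrN; congr (`| _ * _|).
by rewrite /dotz -sumrN; apply: eq_bigr => i _; rewrite mxE rmorphN/= mulNr.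
Qed.

Lemma normzN (R : realType) (n : nat) (k : 'rV[int]_n) :
  normz R (- k) = normz R k.
Proof.
rewrite /normz -[RHS]normrN; congr `|_|.
by apply/matrixP => i j; rewrite !mxE rmorphN.
Qed.

Lemma normc_real (R : rcfType) (x : R) : Normc.normc x%:C%C = `|x|.
Proof. by rewrite /= expr0n/= addr0 sqrtr_sqr. Qed.

Lemma normc_Xomega (R : realType) (n : nat) (omega : 'rV[R]_n)
    (g : 'rV[int]_n -> R[i]) k :
  Normc.normc (Xomega omega g k) = divisor omega k * Normc.normc (g k).
Proof.
rewrite /Xomega Normc.normcM; congr (_ * _).
rewrite 3!Normc.normcM 2!normc_real /divisor 2!normrM.
rewrite -(rmorph_nat (real_complex R)) normc_real /=.
by rewrite expr0n expr1n add0r sqrtr1 mulr1.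
Qed.

Lemma normc_cohom_solution (R : realType) (n : nat) (omega : 'rV[R]_n)
    (f g : 'rV[int]_n -> R[i]) (c : R) k :
  cohom_solution omega f g c -> k != 0 ->
  divisor omega k * Normc.normc (g k) = Normc.normc (f k).
Proof.
move=> [_ + _] k0; rewrite -normc_Xomega => ->.
by rewrite /fourier_cst (negPf k0) subr0.
Qed.

Lemma weight_normz_ge0 (R : realType) (n : nat) (phi : R -> R) (k : 'rV[int]_n) :
  weight phi -> 0 <= phi (normz R k).
Proof. by move=> [_ _ phi0 _ _]; apply: phi0; rewrite in_itv/= andbT; exact: normr_ge0. Qed.

(** Lets [NQ_scale] pull a constant out of the integral. The factors are continuous on [[0, +oo[]
    and on the open set []0, +oo[], which both contain the domain. *)
Lemma measurable_weight_sqr (R : realType) (phi : R -> R) :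
  weight phi -> measurable_fun (`[1, +oo[ : set R) (fun t => phi t / t ^+ 2).
Proof.
move=> [phic _ _ _ _]; apply: measurable_funM.
  apply: (@measurable_funS _ _ _ _ (`[0, +oo[ : set R)) => //.
    by move=> t /=; rewrite !in_itv/= !andbT; exact: le_trans.
  exact: subspace_continuous_measurable_fun.
apply: (@measurable_funS _ _ _ _ (`]0, +oo[ : set R)) => //.
  by move=> t /=; rewrite !in_itv/= !andbT; exact: lt_le_trans.
apply: open_continuous_measurable_fun => // t.
rewrite inE/= in_itv/= andbT => t0.
by apply: cvgV; [rewrite expf_neq0 ?gt_eqF | exact: exprn_continuous].
Qed.

(** Absorbs an exponent into the weight, because [Bruno] asks for exponent 1. The Landau constant of
    [phi] still serves, as [phi <= a * phi]. *)
Lemma NQ_scale (R : realType) (phi : R -> R) (a : R) :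
  1 <= a -> NQ phi -> NQ (fun t => a * phi t).
Proof.
move=> a1 [/[dup] wphi [phic phim phi0 phi00 philn] phiint].
have a0 : 0 <= a by exact: le_trans a1.
split; first split.
- by move=> t; apply: cvgM; [exact: cvg_cst | exact: phic].
- by move=> s t s0 t0 st; rewrite ler_wpM2l// phim.
- by move=> t t0; rewrite mulr_ge0// phi0.
- by rewrite phi00 mulr0.
- apply/eqO_exP; have /eqO_exP[C C0 lnC] := philn.
  exists C => //; apply: filterS lnC => t /le_trans; apply.
  by apply: ler_wpM2l; rewrite ?(ltW C0)// normrM (ger0_norm a0) ler_peMl.
- rewrite [ltLHS](_ : _ = a%:E * \int[lebesgue_measure]_(t in `[1%R, +oo[)
      (phi t / t ^+ 2)%:E)%E.
    by rewrite lte_mul_pinfty// lee_fin.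
  rewrite -ge0_integralZl//.
  + by apply: eq_integral => t _; rewrite -EFinM mulrA.
  + apply/measurable_EFinP; apply: measurable_weight_sqr; exact: wphi.
  + move=> t /=; rewrite in_itv/= andbT => t1; rewrite lee_fin.
    by rewrite divr_ge0 ?exprn_ge0 ?phi0 ?in_itv/= ?andbT ?(le_trans _ t1).
Qed.

Lemma normc_ge0 (R : rcfType) (z : R[i]) : 0 <= Normc.normc z.
Proof. by case: z => x y; exact: sqrtr_ge0. Qed.

Lemma diophantine_cohom_solvable (R : realType) (n : nat) (omega : 'rV[R]_n)
    (phi : R -> R) (tau : R) :
  nonresonant omega -> 0 <= tau -> diophantine n phi tau omega ->
  cohom_solvable omega phi.
Proof.
move=> nr tau0 /(diophantineP _ _ _ _ _ nr) [M dM] f foo.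
have fr : real_fourier f by have /fourier_rP[] := foo 1 ltr01.
(* At [k = 0] the reality condition makes [f 0] its own conjugate, so it can serve as the real
   constant [c]. *)
have f0 : (complex.Re (f 0))%:C%C = f 0.
  have := fr 0; rewrite oppr0; case: (f 0) => x y /= [/eqP].
  by rewrite eqNr => /eqP ->.
have [g gsol] : exists g, cohom_solution omega f g (complex.Re (f 0)).
  by eexists; apply/(cohom_solutionP _ _ nr fr).
exists g, (complex.Re (f 0)); split=> // r /= r0; apply/fourier_rP; split.
  by case: gsol.
have /fourier_rP[_ [N fN]] : fourier_r n phi (r + tau) f.
  by apply: foo => /=; rewrite ltr_pwDl.
have N0 : 0 <= N.
  by apply: le_trans (fN 0); rewrite mulr_ge0 ?expR_ge0 ?normc_ge0.
(* The absolute value makes the bound nonnegative, which the coefficient 0 at [k = 0] requires; [dM]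
   speaks of nonzero frequencies only. *)
exists (`|M| * N) => k; have [->|k0] := eqVneq k 0.
  by case: gsol => _ _ ->; rewrite Normc.normc0 mul0r mulr_ge0.
have D0 := divisor_gt0 _ _ nr k0.
have := normc_cohom_solution _ _ _ _ _ _ _ gsol k0.
move=> /(canRL (mulKf (lt0r_neq0 D0))) ->.
apply: le_trans (ler_wpM2l (normr_ge0 M) (fN k)).
rewrite mulrDl expRD -mulrA [leRHS](_ : _ = `|M| * expR (tau * phi (normz R k)) *
    (Normc.normc (f k) * expR (r * phi (normz R k)))); last by ring.
rewrite ler_wpM2r ?mulr_ge0 ?expR_ge0 ?normc_ge0//.
by apply: le_trans (dM k k0) _; rewrite ler_wpM2r ?expR_ge0 ?ler_norm.
Qed.

(** The bound [1 <= tau] is what [NQ_scale] asks for; the exponents [j + 1] tested in the proof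
    satisfy it. *)
Lemma cohom_solvable_diophantine (R : realType) (n : nat) (omega : 'rV[R]_n)
    (phi : R -> R) :
  nonresonant omega -> weight phi -> cohom_solvable omega phi ->
  exists2 tau : R, 1 <= tau & diophantine n phi tau omega.
Proof.
move=> nr wphi solv; apply/not_exists2P => nodioph.
have {nodioph} : forall j : nat, exists k, k != 0 /\
    j.+1%:R * expR (j.+1%:R * phi (normz R k)) < (divisor omega k)^-1.
  move=> j; apply: contrapT => /forallNP noj.
  have [|] := nodioph j.+1%:R; first by apply; rewrite ler1n.
  apply; apply/diophantineP => //; exists j.+1%:R => k k0.
  by rewrite leNgt; apply/negP => ltj; apply: (noj k).
move=> /choice[u /all_and2[u0 ltu]].
(* Closing the support under negation makes [f] a real series: its coefficients are real and even in
   [k]. *)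
pose S k := `[< exists j, k = u j \/ k = - u j >].
pose f k : R[i] := if S k then (Num.sqrt (divisor omega k))%:C%C else 0.
have SN k : S (- k) = S k.
  apply: asbool_equiv_eq; split=> -[j kj]; exists j.
    by case: kj => [<-|/oppr_inj]; [right; rewrite opprK | left].
  by case: kj => ->; [right | left; rewrite opprK].
have normf k : Normc.normc (f k) = if S k then Num.sqrt (divisor omega k) else 0.
  by rewrite /f; case: ifP; rewrite ?Normc.normc0// normc_real ger0_norm ?sqrtr_ge0.
have Su j : S (u j) by apply/asboolP; exists j; left.
have foo : fourier_oo n phi f.
  move=> r /= r0; apply/fourier_rP; split.
    move=> k; rewrite /f SN divisorN; case: ifP => _; last by rewrite conjc0.
    exact: conjc_real.
  pose F j := Num.sqrt (divisor omega (u j)) * expR (r * phi (normz R (u j))).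
  (* Squaring [F j] turns [r] into [2 * r], and [2 * r <= j + 1] once [j > N], so the choice of
     [u j] gives [F j <= 1]. The finitely many other terms are bounded by their sum. *)
  pose N := Num.truncn (2 * r).
  have F0 j : 0 <= F j by rewrite mulr_ge0 ?sqrtr_ge0 ?expR_ge0.
  exists (\sum_(j < N.+1) F j + 1) => k; rewrite normf; case: ifPn; last first.
    by rewrite mul0r => _; rewrite addr_ge0 ?sumr_ge0.
  move=> /asboolP[j uj].
  have -> : Num.sqrt (divisor omega k) * expR (r * phi (normz R k)) = F j.
    by case: uj => ->; rewrite ?divisorN ?normzN.
  have [jN|Nj] := ltnP j N.+1.
    rewrite (bigD1 (Ordinal jN))//= -addrA lerDl addr_ge0//.
    by rewrite sumr_ge0.
  apply: (@le_trans _ _ 1); last by rewrite lerDr sumr_ge0.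
  have D0 := divisor_gt0 _ _ nr (u0 j).
  rewrite -(@expr_le1 _ 2)// exprMn sqr_sqrtr ?(ltW D0)//.
  rewrite -expRM_natl -ler_pdivlMl// mulr1; apply: le_trans (ltW (ltu j)).
  apply: (@le_trans _ _ (expR (j.+1%:R * phi (normz R (u j))))).
    rewrite ler_expR mulrA ler_wpM2r ?weight_normz_ge0//.
    apply: (le_trans (ltW (truncnS_gt _))).
    by rewrite ler_nat leqW.
  by rewrite ler_peMl ?expR_ge0// ler1n.
have [g [c [gsol goo]]] := solv f foo.
have /fourier_rP[_ [M gM]] := goo 1 ltr01.
(* Then [M ^+ 2 < j + 1], which is at most the inverse divisor at [u j], whereas the bound on [g]
   makes that inverse at most [M ^+ 2]. *)
pose j := Num.truncn (M ^+ 2).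
have D0 := divisor_gt0 _ _ nr (u0 j).
have s0 : 0 < Num.sqrt (divisor omega (u j)) by rewrite sqrtr_gt0.
have ng : Normc.normc (g (u j)) = (Num.sqrt (divisor omega (u j)))^-1.
  have := normc_cohom_solution _ _ _ _ _ _ _ gsol (u0 j).
  rewrite normf Su => /(canRL (mulKf (lt0r_neq0 D0))) ->.
  rewrite -{1}(sqr_sqrtr (ltW D0)) expr2 invfM -mulrA mulVf ?mulr1//.
  exact: lt0r_neq0.
have e1 k : 1 <= expR (1 * phi (normz R k)).
  by rewrite mul1r -expR0 ler_expR weight_normz_ge0.
have gle : (Num.sqrt (divisor omega (u j)))^-1 <= M.
  by rewrite -ng; apply: le_trans (gM (u j)); rewrite ler_peMr ?normc_ge0.
have : (divisor omega (u j))^-1 <= M ^+ 2.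
  rewrite -{1}(sqr_sqrtr (ltW D0)) -exprVn lerXn2r// ?nnegrE ?invr_ge0 ?ltW//.
  by apply: lt_le_trans gle; rewrite invr_gt0.
apply/negP; rewrite -ltNge; apply: lt_le_trans (truncnS_gt _) _.
apply: le_trans (ltW (ltu j)); rewrite ler_peMr// -expR0 ler_expR.
by rewrite mulr_ge0// weight_normz_ge0.
Qed.

Theorem lemma2p4 (R : realType) (n : nat) (omega : 'rV[R]_n) :
  (2 <= n)%N -> nonresonant omega ->
  (omega \in Bruno <->
   exists2 phi : R -> R, phi \in NQ & cohom_solvable omega phi).
Proof.
move=> _ nr; split=> [|[phi]]; rewrite !inE.
  move=> -[phi NQphi dphi]; exists phi; first by rewrite inE.
  exact: diophantine_cohom_solvable dphi.
move=> NQphi /(cohom_solvable_diophantine _ _ _ _ nr (proj1 NQphi))[tau tau1].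
move=> /(diophantineP _ _ _ _ _ nr)[M dM].
exists (fun t => tau * phi t); first exact: NQ_scale.
by apply/diophantineP => //; exists M => k /dM; rewrite mul1r.
Qed.
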